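(* Let $H$ be a max-id.\ distribution function on $\mathbb{R}^d$ with unit Fréchet marginal df's, and let $Q$ be a $d$-dimensional df with unit Fréchet marginal df's (so $Q$ and $H$ have the same marginals). Then $$\mu(H,Q)=\lim_{n\to\infty} n\int_{\mathbb{R}^d}\bigl[1-H^{1/n}(x_1,\ldots,x_d)\bigr]\,dQ(x_1,\ldots,x_d),\qquad \lambda(Q,H)=\lim_{n\to\infty} n\int_{\mathbb{R}^d}Q(x_1,\ldots,x_d)\,dH^{1/n}(x_1,\ldots,x_d).$$ Moreover, $$\mu(H,Q)=d+\sum_{i=2}^d(-1)^{i+1}\sum_{K\subset\{1,\ldots,d\},\,|K|=i}\lambda(Q_K,H_K)$$ and $$\lambda(Q,H)=d+\sum_{i=2}^d(-1)^{i+1}\sum_{K\subset\{1,\ldots,d\},\,|K|=i}\mu(H_K,Q_K).$$ In particular, for $d=2$, $\mu(H,Q)=2-\lambda(Q,H)$.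
   Context: Unit Fréchet df: $\Phi(x)=e^{-1/x}$ for $x>0$, $\Phi(x)=0$ for $x\le 0$. A $d$-dimensional df $H$ is max-id.\ if $H^t$ is a df for every $t>0$. For a max-id.\ df $H$ with unit Fréchet marginals, its exponent measure $\upsilon$ is the measure on $E=[0,\infty]^d\setminus\{(0,\ldots,0)\}$ with $H(x)=\exp(-\upsilon(E\setminus[0,x]))$ for $x\in(0,\infty)^d$. For $d$-dimensional df's $H,Q$ with the same (unit Fréchet) marginals and $\vec Z=(Z_1,\ldots,Z_d)\sim Q$, define $\mu(H,Q)=-\mathbb{E}[\ln H(Z_1,\ldots,Z_d)]$ and $\lambda(Q,H)=\int_{(0,\infty)^d}Q\,d\upsilon$ where $\upsilon$ is the exponent measure of $H$. For a nonempty $K\subset\{1,\ldots,d\}$, $H_K,Q_K$ denote the marginal df's of $H,Q$ of the coordinates in $K$, and $|K|$ the cardinality of $K$. *)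

(* Defs.v *)
From HB Require Import structures.
From mathcomp Require Import all_boot all_order all_algebra.
From mathcomp Require Import all_classical all_reals all_analysis measurable_realfun.
Set Implicit Arguments. Unset Strict Implicit. Unset Printing Implicit Defensive.
Import Order.TTheory GRing.Theory Num.Theory.
Local Open Scope classical_set_scope.
Local Open Scope ring_scope.

(* R^n is modelled as n.-tuple R (with the product sigma-algebra of the
   Borel sigma-algebras, provided by mathcomp-analysis), and [0,oo]^n
   as a subset of n.-tuple (\bar R). *)

Section defs.
Variable R : realType.

Definition frechet (x : R) : R := if 0 < x then expR (- x^-1) else 0.

Definition lorth n (x : n.-tuple R) : set (n.-tuple R) :=
  [set y | forall i, tnth y i <= tnth x i].

Definition is_df_of n (P : probability (n.-tuple R) R) (F : n.-tuple R -> R) :=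
  forall x, P (lorth x) = (F x)%:E.

Definition is_df n (F : n.-tuple R -> R) :=
  exists P : probability (n.-tuple R) R, is_df_of P F.

Definition frechet_margins n (P : probability (n.-tuple R) R) :=
  forall (i : 'I_n) (t : R), P [set y | tnth y i <= t] = (frechet t)%:E.

Definition max_id n (H : n.-tuple R -> R) :=
  forall t : R, 0 < t -> is_df (fun x => H x `^ t).

Definition coordK n (K : {set 'I_n}) (x : n.-tuple R) : #|K|.-tuple R :=
  [tuple tnth x (enum_val j) | j < #|K|].

Definition margdf n (P : probability (n.-tuple R) R) (K : {set 'I_n})
  (z : #|K|.-tuple R) : R :=
  fine (P [set y | forall j : 'I_#|K|, tnth y (enum_val j) <= tnth z j]).

Definition Eset n : set (n.-tuple (\bar R)) :=
  [set y | (forall i, (0 <= tnth y i)%E) /\ exists i, tnth y i != 0%E].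
Arguments Eset n : clear implicits.

Definition box0 n (x : n.-tuple R) : set (n.-tuple (\bar R)) :=
  [set y | forall i, (0 <= tnth y i <= (tnth x i)%:E)%E].

Definition posR n : set (n.-tuple R) := [set x | forall i, 0 < tnth x i].
Definition posE n : set (n.-tuple (\bar R)) :=
  [set y | forall i, (0%E < tnth y i < +oo)%E].
Arguments posE n : clear implicits.

Definition is_exp_measure n (H : n.-tuple R -> R)
    (v : {measure set (n.-tuple (\bar R)) -> \bar R}) :=
  v (~` Eset n) = 0%E /\
  forall x, posR x -> (H x)%:E = expeR (- v (Eset n `\` box0 x)).

(* mu(H,Q) = - E[ln H(Z)] where Z ~ Q is the random vector Z on (T,P) *)
Definition muHQ (d : measure_display) (T : measurableType d)
  (P : probability T R) n (H : n.-tuple R -> R) (Z : T -> n.-tuple R) : \bar R :=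
  (\int[P]_w (- ln (H (Z w)))%:E)%E.

(* lambda(Q,H) = int_{(0,oo)^n} Q dv, v the exponent measure of H *)
Definition lamQH n (Q : n.-tuple R -> R)
    (v : {measure set (n.-tuple (\bar R)) -> \bar R}) : \bar R :=
  (\int[v]_(y in posE n) (Q (map_tuple fine y))%:E)%E.

End defs.

Arguments margdf {R n} P K z.
Arguments coordK {R n} K x.

(* Main.v *)
(** Write [v] for the exponent measure of [H], [b_J] for the marginal df of [H] in the
    coordinates [J], and [L_J = - ln b_J]. Letting coordinates tend to infinity in the
    defining relation of [v] gives, for positive [z],
      [v {y | y_i > z_i for some i in J} = L_J z],
    and in particular the coordinates of [v] have tails [1 / t]. By Tonelli and
    inclusion-exclusion,
      [lambda(Q,H) = int v {y | y_i >= z_i for all i} dQ(z)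
                   = sum_J (-1)^(|J|+1) int L_J dQ],
    and [int L_J dQ = mu(H_J,Q_J)] is 1 when [|J| = 1] because [1/Z_i] is standard
    exponential. The same identity for all [K] in place of the full index set, inverted by
    Moebius inversion over subsets, gives the formula for [mu(H,Q)].
    As [n (1 - b^(1/n))] converges to [- ln b] and is dominated by it, and as
    [L_J <= sum_i 1/z_i] is integrable, the first limit holds for every [b_J]; Tonelli and
    inclusion-exclusion applied to the law with df [H^(1/n)] reduce the second limit to it. *)

Require Import Defs.
From HB Require Import structures.
From mathcomp Require Import all_boot all_order all_algebra.
From mathcomp Require Import all_classical all_reals all_analysis measurable_realfun.
From mathcomp Require Import lra.
Set Implicit Arguments.
Unset Strict Implicit.
Unset Printing Implicit Defensive.

Import Order.TTheory GRing.Theory Num.Theory.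
Import numFieldNormedType.Exports.
Local Open Scope classical_set_scope.
Local Open Scope ring_scope.

(** * Inclusion-exclusion for finite families of sets *)

(** Expanding the right-hand product, [J] collects the factors from which [- a i] is taken. This one
    identity yields the vanishing of alternating sums, inclusion-exclusion and Moebius inversion. *)
Lemma sum_prod_opp_subset (R : comPzRingType) (I : finType) (a : I -> R) :
  \sum_(J : {set I}) (-1) ^+ #|J| * \prod_(i in J) a i = \prod_i (1 - a i).
Proof.
under [RHS]eq_bigr do rewrite addrC.
rewrite (@bigA_distr _ _ 1 *%R +%R); apply: eq_bigr => J _.
by rewrite -big_mkcond /= prodrN.
Qed.

Lemma sum_sign_set (R : comPzRingType) (I : finType) : (0 < #|I|)%N ->
  \sum_(J : {set I}) (-1) ^+ #|J| = 0 :> R.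
Proof.
move=> I0.
transitivity (\sum_(J : {set I}) (-1) ^+ #|J| * \prod_(i in J) (1 : R)).
  by apply: eq_bigr => J _; rewrite big1 ?mulr1.
by rewrite sum_prod_opp_subset subrr prodr_const expr0n -leqn0 leqNgt I0.
Qed.

(** The dual form of inclusion-exclusion, an intersection in terms of unions, because the exponent
    measure is known explicitly on unions of exceedances. The product of [1 - \1_(A i)] over [J] is
    one minus the indicator of the union over [J]; the constants cancel by [sum_sign_set], and the
    sign moves into the exponent [#|J|.+1]. The empty [J] contributes zero. *)
Lemma indic_forall_inclusion_exclusion (R : realType) (T : Type) (I : finType)
    (A : I -> set T) (w : T) : (0 < #|I|)%N ->
  \1_[set w | forall i, A i w] w = \sum_(J : {set I}) (-1) ^+ #|J|.+1 *
    \1_[set w | exists2 i, i \in J & A i w] w :> R.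
Proof.
move=> I0; transitivity (\prod_i (1 - (1 - \1_(A i) w : R))).
  under eq_bigr do rewrite opprB addrC subrK.
  rewrite indicE; have [Aw|nAw] := boolP (w \in _).
    by rewrite big1// => i _; move: Aw; rewrite inE => /(_ i) ?; rewrite indicE mem_set.
  move: nAw; rewrite notin_setE /= => /existsNP[i nAi].
  by rewrite (bigD1 i)//= indicE memNset// mul0r.
rewrite -sum_prod_opp_subset; transitivity (\sum_(J : {set I}) (-1) ^+ #|J| *
    (1 - \1_[set w | exists2 i, i \in J & A i w] w : R)).
  apply: eq_bigr => J _; congr (_ * _); rewrite [in RHS]indicE.
  have [|nU] := boolP (w \in _).
    rewrite inE => -[i iJ Aw].
    by rewrite subrr (bigD1 i)//= indicE mem_set// subrr mul0r.
  rewrite subr0 big1// => i iJ; rewrite indicE memNset ?subr0// => Aw.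
  by move: nU; rewrite notin_setE; apply; exists i.
under eq_bigr do rewrite mulrBr mulr1.
rewrite big_split /= sum_sign_set// add0r.
by apply: eq_bigr => J _; rewrite exprS mulN1r mulNr.
Qed.

Lemma finite_measure_indic_integrable d (T : measurableType d) (R : realType)
    (m : {measure set T -> \bar R}) (A : set T) :
  measurable A -> (m A < +oo)%E -> m.-integrable setT (fun w => (\1_A w)%:E).
Proof.
move=> mA mAoo; apply/integrableP; split.
  by apply/measurable_EFinP; exact: measurable_indic.
under eq_integral do rewrite gee0_abs ?lee_fin//.
by rewrite integral_indic// setIT.
Qed.

Section families_of_sets.
Context d (T : measurableType d) (R : realType) (m : {measure set T -> \bar R}).
Context (I : finType) (A : I -> set T) (mA : forall i, measurable (A i)).

Lemma measurable_forall_in (J : {set I}) :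
  measurable [set w | forall i, i \in J -> A i w].
Proof.
rewrite (_ : mkset _ = \bigcap_(i in [set i | i \in J]) A i)//.
by apply: fin_bigcap_measurable => //; exact: finite_finset.
Qed.

Lemma measurable_forall : measurable [set w | forall i, A i w].
Proof.
rewrite (_ : mkset _ = \bigcap_(i in [set: I]) A i); last first.
  by apply/seteqP; split=> w /= Aw i; [move=> _; exact: Aw|exact: Aw].
by apply: fin_bigcap_measurable => //; exact: finite_finset.
Qed.

Lemma measurable_exists_in (J : {set I}) :
  measurable [set w | exists2 i, i \in J & A i w].
Proof.
rewrite (_ : mkset _ = \bigcup_(i in [set i | i \in J]) A i)//.
by apply: fin_bigcup_measurable => //; exact: finite_finset.
Qed.

Lemma measure_exists_in_le (J : {set I}) :
  (m [set w | exists2 i, i \in J & A i w] <= \sum_(i in J) m (A i))%E.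
Proof.
rewrite (_ : mkset _ = \bigcup_(i in [set` J]) A i)// bigcup_pred.
suff [] : measurable (\big[setU/set0]_(i in J) A i) /\
  (m (\big[setU/set0]_(i in J) A i) <= \sum_(i in J) m (A i))%E by [].
apply: (big_ind2 (fun X s => measurable X /\ (m X <= s)%E)) => //.
  by rewrite measure0.
move=> X s Y t [mX Xs] [mY Yt]; split; first exact: measurableU.
by apply: le_trans (leeD Xs Yt); exact: measureU2.
Qed.

(** Integrate the identity for indicators. The total mass of [m] may be infinite; finiteness of each
    [m (A i)] makes the indicators of the unions integrable, so the sum and the integral commute. *)
Lemma measure_inclusion_exclusion : (0 < #|I|)%N -> (forall i, (m (A i) < +oo)%E) ->
  m [set w | forall i, A i w] =
  (\sum_(J : {set I}) ((-1) ^+ #|J|.+1)%:E * m [set w | exists2 i, i \in J & A i w])%E.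
Proof.
move=> I0 Aoo.
have intU (J : {set I}) :
    m.-integrable setT (fun w => (\1_[set w | exists2 i, i \in J & A i w] w)%:E).
  apply: finite_measure_indic_integrable; first exact: measurable_exists_in.
  by apply: (le_lt_trans (measure_exists_in_le J)); exact: lte_sum_pinfty.
rewrite -[X in m X = _]setIT -integral_indic//; last exact: measurable_forall.
under eq_integral do rewrite indic_forall_inclusion_exclusion// -sumEFin.
rewrite integral_sum//; last first.
  by move=> J; under eq_fun do rewrite EFinM; exact: integrableZl.
apply: eq_bigr => J _; under eq_integral do rewrite EFinM.
by rewrite integralZl// integral_indic ?setIT//; exact: measurable_exists_in.
Qed.

End families_of_sets.

(** * Exceedance sets and continuity of tails *)

(** The variables take extended real values so that one notion serves both the exponent measure on
    [[0,oo]^n] and laws on [R^n]. *)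
Definition exceed (R : realType) (T : Type) n (Y : 'I_n -> T -> \bar R) (J : {set 'I_n})
    (z : n.-tuple R) : set T :=
  [set w | exists2 i, i \in J & ((tnth z i)%:E < Y i w)%E].

Section tail_measures.
Context d (T : measurableType d) (R : realType).

Lemma measurable_lt_cst (Y : T -> \bar R) (t : \bar R) : measurable_fun setT Y ->
  measurable [set w | (t < Y w)%E].
Proof. by move=> mY; rewrite -[X in measurable X]setTI; exact: emeasurable_fun_o_infty. Qed.

Lemma measurable_eq_cst (Y : T -> \bar R) (t : \bar R) : measurable_fun setT Y ->
  measurable [set w | Y w = t].
Proof.
by move=> mY; rewrite -[X in measurable X]setTI; apply: measurable_eqe => //; exact: measurable_cst.
Qed.

(* The mass at level [t] is at most [g s - g t] for every [s < t]. *)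
Lemma continuous_tail_no_atom (m : {measure set T -> \bar R}) (Y : T -> \bar R)
    (g : R -> R) (t : R) : measurable_fun setT Y -> 0 < t -> {for t, continuous g} ->
  (forall s, 0 < s -> m [set w | (s%:E < Y w)%E] = (g s)%:E) ->
  m [set w | Y w = t%:E] = 0%E.
Proof.
move=> mY t0 gt mg; apply/eqP; rewrite eq_le measure_ge0 andbT.
have le_diff s : 0 < s -> s < t -> (m [set w | Y w = t%:E] + (g t)%:E <= (g s)%:E)%E.
  move=> s0 st; rewrite -mg// -measureU//.
  - rewrite -mg//; apply: le_measure.
    + rewrite inE; apply: measurableU; [exact: measurable_eq_cst|exact: measurable_lt_cst].
    + by rewrite inE; exact: measurable_lt_cst.
    + move=> w [/= ->|/=]; first by rewrite lte_fin.
      by apply: lt_trans; rewrite lte_fin.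
  - exact: measurable_eq_cst.
  - exact: measurable_lt_cst.
  - by apply/seteqP; split=> w //= [->]; rewrite ltxx.
apply/lee_addgt0Pr => e e0; rewrite add0e.
have /cvgrPdist_lt /(_ _ e0) [r /= r0 gr] := gt.
(* [s] is within [r] of [t], so [g s] is close to [g t], and it stays positive, as the tail formula
   is available at positive levels only. *)
pose s := Num.max (t - r / 2) (t / 2).
have s0 : 0 < s by rewrite lt_max; apply/orP; right; lra.
have st : s < t.
  by rewrite gt_max; apply/andP; split; lra.
have gs : g s - g t < e.
  rewrite (le_lt_trans (ler_norm _))// distrC; apply: gr => /=.
  rewrite ger0_norm ?subr_ge0 ?(ltW st)// ltrBlDr -ltrBlDl lt_max.
  by apply/orP; left; lra.
have := le_diff _ s0 st; rewrite -leeBrDr// -EFinB => /le_trans; apply.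
by rewrite lee_fin ltW.
Qed.

End tail_measures.

(** * Tonelli's theorem combined with inclusion-exclusion *)

Section tonelli_inclusion_exclusion.
Context d (T : measurableType d) (R : realType).
Context (m : {sigma_finite_measure set T -> \bar R}) (n : nat).
Context (Y : 'I_n -> T -> \bar R) (P : probability (n.-tuple R) R).
Context (G : {set 'I_n} -> n.-tuple R -> R).
Hypothesis mY : forall i, measurable_fun setT (Y i).
Hypothesis n0 : (0 < n)%N.
Hypothesis P_pos : P (~` @posR R n) = 0%E.
Hypothesis mG : forall J z, posR z -> m (exceed Y J z) = (G J z)%:E.
Hypothesis no_atom : forall i t, 0 < t -> m [set w | Y i w = t%:E] = 0%E.
Hypothesis intG : forall J, P.-integrable setT (EFin \o G J).

Let dom := [set wz : T * n.-tuple R | forall i, ((tnth wz.2 i)%:E <= Y i wz.1)%E].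

Lemma measurable_posR : measurable (@posR R n).
Proof.
rewrite (_ : @posR R n =
  [set x : n.-tuple R | forall i : 'I_n, [set x | (0 < (tnth x i)%:E)%E] x])//.
apply: measurable_forall => i; apply: measurable_lt_cst.
by apply/measurable_EFinP; exact: measurable_tnth.
Qed.

Let measurable_dom : measurable dom.
Proof.
apply: (@measurable_forall _ _ _ (fun i => [set wz : T * n.-tuple R |
  ((tnth wz.2 i)%:E <= Y i wz.1)%E])) => i.
rewrite -[X in measurable X]setTI; apply: measurable_lee => //.
  apply/measurable_EFinP; apply: (@measurableT_comp _ _ _ _ _ _ (fun z => tnth z i)) => //.
  exact: measurable_tnth.
exact: measurableT_comp.
Qed.

Lemma measurable_prob_le :
  measurable_fun setT (fun w => P [set z | forall i, ((tnth z i)%:E <= Y i w)%E]).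
Proof.
rewrite (_ : (fun w => _) = P \o xsection dom); first exact: measurable_fun_xsection.
by apply/funext => w /=; congr (P _); apply/seteqP; split => z /=; rewrite /xsection /= inE.
Qed.

(** The two events differ only inside [N], a finite union of null atoms. The weak inequality comes
    from the definition of a df, the strict one from exceedance sets. *)
Lemma measure_forall_le_lt (z : n.-tuple R) : posR z ->
  m [set w | forall i, ((tnth z i)%:E <= Y i w)%E] =
  m [set w | forall i, ((tnth z i)%:E < Y i w)%E].
Proof.
move=> z0; pose N := [set w | exists2 i, i \in [set: 'I_n]%SET & Y i w = (tnth z i)%:E].
have mN : measurable N.
  by apply: (@measurable_exists_in _ _ _ (fun i => [set w | Y i w = (tnth z i)%:E])) => i;
    exact: measurable_eq_cst.
have N0 : m N = 0%E.
  apply/eqP; rewrite eq_le measure_ge0 andbT.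
  apply: (le_trans (@measure_exists_in_le _ _ _ m _
    (fun i => [set w | Y i w = (tnth z i)%:E]) _ _)).
    by move=> i; exact: measurable_eq_cst.
  by rewrite big1// => i _; exact: no_atom.
have m1 : measurable [set w | forall i, ((tnth z i)%:E <= Y i w)%E].
  apply: (@measurable_forall _ _ _ (fun i => [set w | ((tnth z i)%:E <= Y i w)%E])) => i.
  by rewrite -[X in measurable X]setTI; exact: emeasurable_fun_c_infty.
have m2 : measurable [set w | forall i, ((tnth z i)%:E < Y i w)%E].
  apply: (@measurable_forall _ _ _ (fun i => [set w | ((tnth z i)%:E < Y i w)%E])) => i.
  exact: measurable_lt_cst.
apply/eqP; rewrite eq_le; apply/andP; split; last first.
  by apply: le_measure; rewrite ?inE// => w /= zw i; exact: ltW.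
rewrite -[leRHS]adde0 -N0; apply: (le_trans _ (measureU2 _ _ _)) => //.
apply: le_measure; rewrite ?inE//; first exact: measurableU.
move=> w /= zw; have [Nw|nNw] := pselect (N w); [by right|left => i].
rewrite lt_neqAle zw andbT; apply/eqP => e; apply: nNw.
by exists i; rewrite ?inE.
Qed.

(** The left side is the product measure of [dom], integrated first in [z]. Integrating first in [w]
    instead, the section at a positive [z] is an intersection of exceedances, to which
    inclusion-exclusion applies; non-positive [z] are [P]-null. It is applied with [m] the exponent
    measure and [G J = - ln b_J], and with [m] the law of df [H^r] and [G J = 1 - b_J^r]. *)
Lemma tonelli_inclusion_exclusion :
  (\int[m]_w P [set z | forall i, ((tnth z i)%:E <= Y i w)%E] =
   \sum_(J : {set 'I_n}) ((-1) ^+ #|J|.+1)%:E * \int[P]_z (G J z)%:E)%E.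
Proof.
have := indic_fubini_tonelli m P measurable_dom.
rewrite indic_fubini_tonelli_FE// indic_fubini_tonelli_GE// => tonelli.
transitivity (\int[m]_w (P \o xsection dom) w)%E.
  by apply: eq_integral => w _ /=; congr (P _); apply/seteqP; split => z /=;
    rewrite /xsection /= inE.
rewrite tonelli.
have intsum (J : {set 'I_n}) :
    P.-integrable setT (fun z => ((-1) ^+ #|J|.+1)%:E * (G J z)%:E)%E.
  by have := integrableZl measurableT ((-1) ^+ #|J|.+1) (intG J).
transitivity (\int[P]_z (\sum_(J : {set 'I_n}) ((-1) ^+ #|J|.+1)%:E * (G J z)%:E))%E.
  apply: ae_eq_integral => //.
  - exact: measurable_fun_ysection.
  - by apply: measurable_int; exact: integrable_sum.
  exists (~` @posR R n); split; [by apply: measurableC; exact: measurable_posR|exact: P_pos|].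
  apply: subsetCl => z /contrapT zpos _ /=.
  rewrite (_ : ysection dom z = [set w | forall i, ((tnth z i)%:E <= Y i w)%E]); last first.
    by apply/seteqP; split => w /=; rewrite /ysection /= inE.
  rewrite measure_forall_le_lt//; have IE := @measure_inclusion_exclusion _ _ _ m 'I_n
    (fun i => [set w | ((tnth z i)%:E < Y i w)%E]).
  have tail_fin i : (m [set w | ((tnth z i)%:E < Y i w)%E] < +oo)%E.
    rewrite [X in m X](_ : _ = exceed Y [set i]%SET z) ?mG ?ltry//.
    apply/seteqP; split => w /=; first by exists i; rewrite ?inE.
    by move=> [j]; rewrite inE => /eqP ->.
  rewrite IE ?card_ord//; last by move=> i; exact: measurable_lt_cst.
  by apply: eq_bigr => J _; rewrite -mG.
rewrite integral_sum//; apply: eq_bigr => J _.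
exact: (integralZl measurableT (intG J)).
Qed.

End tonelli_inclusion_exclusion.

(** * Marginal dfs as limits of the full df *)

(** The marginal df in the coordinates of [J], kept as a function of the full vector so that all [J]
    share one type. It is constantly 1 for empty [J]. *)
Definition partial_df (R : realType) n (P : probability (n.-tuple R) R) (J : {set 'I_n})
    (z : n.-tuple R) : R :=
  fine (P [set y | forall i, i \in J -> tnth y i <= tnth z i]).

(** The coordinates outside [J] tend to infinity with [N]; the value [N.+1] rather than [N] keeps
    positive vectors positive from the start. *)
Definition stretch (R : realType) n (J : {set 'I_n}) (z : n.-tuple R) (N : nat) : n.-tuple R :=
  [tuple if i \in J then tnth z i else N.+1%:R | i < n].

Section partial_df.
Context (R : realType) (n : nat).
Implicit Types (P Pr : probability (n.-tuple R) R) (J : {set 'I_n}) (z : n.-tuple R).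

Lemma measurable_tnth_le (i : 'I_n) (t : R) : measurable [set y : n.-tuple R | tnth y i <= t].
Proof.
rewrite -[X in measurable X]setTI (_ : mkset _ = (fun y => tnth y i) @^-1` `]-oo, t]).
  by apply: measurable_tnth => //; exact: measurable_itv.
by apply/seteqP; split => y /=; rewrite in_itv.
Qed.

Lemma measurable_orthant J z :
  measurable [set y : n.-tuple R | forall i, i \in J -> tnth y i <= tnth z i].
Proof.
apply: (@measurable_forall_in _ _ _ (fun i => [set y : n.-tuple R | tnth y i <= tnth z i])).
by move=> i; exact: measurable_tnth_le.
Qed.

Lemma partial_dfE P J z :
  P [set y | forall i, i \in J -> tnth y i <= tnth z i] = (partial_df P J z)%:E.
Proof. by rewrite fineK// fin_num_measure//; exact: measurable_orthant. Qed.

Lemma partial_df_le1 P J z : partial_df P J z <= 1.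
Proof. by rewrite -lee_fin -partial_dfE probability_le1//; exact: measurable_orthant. Qed.

Lemma partial_dfS P J (K : {set 'I_n}) z : J \subset K -> partial_df P K z <= partial_df P J z.
Proof.
move=> /fintype.subsetP JK; rewrite -lee_fin -!partial_dfE le_measure ?inE//.
- exact: measurable_orthant.
- exact: measurable_orthant.
- by move=> y /= Hy i /JK; exact: Hy.
Qed.

Lemma partial_df_setT P H z : is_df_of P H -> partial_df P [set: 'I_n]%SET z = H z.
Proof.
move=> PH; rewrite /partial_df (_ : mkset _ = lorth z) ?PH//.
by apply/seteqP; split => y /= Hy i => [|_]; apply: Hy; rewrite ?inE.
Qed.

Lemma exceed_partial_df P J z :
  P (exceed (fun i y => (tnth y i)%:E) J z) = (1 - partial_df P J z)%:E.
Proof.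
rewrite (_ : exceed _ _ _ = ~` [set y | forall i, i \in J -> tnth y i <= tnth z i]).
  by rewrite probability_setC ?partial_dfE//; exact: measurable_orthant.
apply/seteqP; split => y /=.
  by move=> [i iJ]; rewrite lte_fin ltNge => /negP zy /(_ _ iJ).
by move=> /existsNP[i /not_implyP[iJ /negP]]; rewrite -ltNge => zy; exists i; rewrite ?lte_fin.
Qed.

(** The orthants below [stretch J z N] increase to the event that constrains only the coordinates in
    [J], so this is continuity from below. *)
Lemma df_stretch_cvg P H J z : is_df_of P H ->
  H (stretch J z N) @[N --> \oo] --> partial_df P J z.
Proof.
move=> PH.
suff : (H (stretch J z N))%:E @[N --> \oo] --> (partial_df P J z)%:E by move/fine_cvgP => [].
rewrite -partial_dfE.
rewrite (_ : mkset _ = \bigcup_N lorth (stretch J z N)).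
  rewrite [X in X @ _ --> _](_ : _ = P \o (fun N => lorth (stretch J z N))).
    apply: nondecreasing_cvg_mu.
    - move=> N; rewrite (_ : lorth _ = [set y : n.-tuple R |
        forall i, i \in [set: 'I_n]%SET -> tnth y i <= tnth (stretch J z N) i]).
        exact: measurable_orthant.
      by apply/seteqP; split => y /= Hy i => [_|]; apply: Hy; rewrite ?inE.
    - apply: bigcupT_measurable => N; rewrite (_ : lorth _ = [set y : n.-tuple R |
        forall i, i \in [set: 'I_n]%SET -> tnth y i <= tnth (stretch J z N) i]).
        exact: measurable_orthant.
      by apply/seteqP; split => y /= Hy i => [_|]; apply: Hy; rewrite ?inE.
    - move=> N M NM; rewrite subsetEset => y /= Hy i; apply: (le_trans (Hy i)).
      by rewrite !tnth_mktuple; case: ifP => // _; rewrite ler_nat.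
  by apply/funext => N /=; rewrite PH.
apply/seteqP; split => y /=; last first.
  by move=> [N _ Hy] i iJ; move: (Hy i); rewrite tnth_mktuple iJ.
(* Truncating the sum of absolute values gives a single [N] that bounds every coordinate of [y]. *)
move=> Hy; pose N := Num.truncn (\sum_i `|tnth y i|); exists N => // i.
rewrite tnth_mktuple; case: ifP => [|_]; first exact: Hy.
apply: (le_trans (ler_norm _)); apply: ltW; apply: le_lt_trans (truncnS_gt _).
by rewrite (bigD1 i)//= lerDl sumr_ge0.
Qed.

(** Both marginals are limits along [stretch]. Positivity of the limit allows the power to be
    written as [expR (r * ln _)], which is continuous there. *)
Lemma partial_df_pow P H Pr (r : R) J z :
  is_df_of P H -> is_df_of Pr (fun x => H x `^ r) -> 0 < partial_df P J z ->
  partial_df Pr J z = partial_df P J z `^ r.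
Proof.
move=> PH PrH b0; have HJ := @df_stretch_cvg P H J z PH.
have <- := cvg_lim (@Rhausdorff R) (@df_stretch_cvg Pr _ J z PrH); apply: cvg_lim => //=.
have Hpos : \forall N \near \oo, 0 < H (stretch J z N) by exact: (cvgr_gt _ HJ).
rewrite [in X in _ --> X]/powR gt_eqF//.
apply: (@cvg_trans _ (expR (r * ln (H (stretch J z N))) @[N --> \oo])).
  by apply: near_eq_cvg; near do rewrite /powR gt_eqF//.
apply: (@cvg_comp _ _ _ (fun N => r * ln (H (stretch J z N))) expR); last first.
  exact: continuous_expR.
apply: cvgMr; apply: (@cvg_comp _ _ _ _ (@ln R)); [exact: HJ|exact: continuous_ln].
Unshelve. all: by end_near. Qed.

End partial_df.

(** * Mass of exceedance sets under the exponent measure *)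

Section exponent_measure.
Context (R : realType) (n : nat) (P : probability (n.-tuple R) R) (H : n.-tuple R -> R).
Context (v : {measure set (n.-tuple (\bar R)) -> \bar R}).
Hypothesis PH : is_df_of P H.
Hypothesis P_frechet : frechet_margins P.
Hypothesis vH : is_exp_measure H v.

Local Notation coord := (fun (i : 'I_n) (y : n.-tuple (\bar R)) => tnth y i).

Lemma measurable_exceed_coord (J : {set 'I_n}) (x : n.-tuple R) : measurable (exceed coord J x).
Proof.
apply: (@measurable_exists_in _ _ _
  (fun i => [set y : n.-tuple (\bar R) | ((tnth x i)%:E < tnth y i)%E])) => i.
by apply: measurable_lt_cst; exact: measurable_tnth.
Qed.

Lemma measurable_Eset : measurable (@Eset R n).
Proof.
apply: measurableI.
  apply: (@measurable_forall _ _ _ (fun i => [set y : n.-tuple (\bar R) | (0 <= tnth y i)%E])).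
  move=> i; rewrite -[X in measurable X]setTI.
  by apply: emeasurable_fun_c_infty => //; exact: measurable_tnth.
rewrite [X in measurable X](_ : _ = [set y : n.-tuple (\bar R) |
    exists2 i, i \in [set: 'I_n]%SET & [set y | tnth y i != 0%E] y]).
  apply: measurable_exists_in => i.
  rewrite -[X in measurable X]setTI; apply: measurable_neqe => //; exact: measurable_tnth.
by apply/seteqP; split => y [i yi]; exists i; rewrite ?inE.
Qed.

Lemma exp_measure_exceedT (x : n.-tuple R) : posR x ->
  (H x)%:E = expeR (- v (exceed coord [set: 'I_n]%SET x)).
Proof.
move=> x0; case: vH => vE /(_ x x0) ->; congr (expeR (- _)).
have mE := measurable_Eset; have mU := measurable_exceed_coord [set: 'I_n]%SET x.
have -> : @Eset R n `\` box0 x = exceed coord [set: 'I_n]%SET x `&` @Eset R n.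
  apply/seteqP; split => y /=.
    move=> [Ey /existsNP[i /negP yx]]; split => //; exists i; rewrite ?inE//.
    by move: yx; case: Ey => [/(_ i) -> _] /=; rewrite ltNge.
  move=> [[i _ xy] Ey]; split => // /(_ i) /andP[_].
  by rewrite leNgt xy.
rewrite -(measureU0 (mu := v) _ (measurableC mE) vE); last exact: measurableI.
rewrite setUIl setUv setIT measureU0//; exact: measurableC.
Qed.

Lemma measurable_eqy (i : 'I_n) : measurable [set y : n.-tuple (\bar R) | tnth y i = +oo%E].
Proof. by apply: measurable_eq_cst; exact: measurable_tnth. Qed.

(* In the defining relation of [v] the coordinates outside [J] tend to infinity. The
   decreasing limit keeps the points with an infinite coordinate; these can be discarded
   only after [exp_measure_infty], which is itself a consequence. *)
Let exceed_or_infty (J : {set 'I_n}) (x : n.-tuple R) : posR x -> 0 < partial_df P J x ->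
  v (exceed coord J x `|` [set y | exists2 i, i \in ~: J & tnth y i = +oo%E]) =
  (- ln (partial_df P J x))%:E.
Proof.
move=> x0 b0; have HJ := @df_stretch_cvg _ _ P H J x PH.
have spos N : posR (stretch J x N).
  by move=> i; rewrite tnth_mktuple; case: ifP => // _; exact: x0.
(* Starting the sequence at [N0] makes every [H] value positive, so that [F 0] has finite mass, as
   continuity from above requires. *)
have [N0 _ Hpos] : \forall N \near \oo, 0 < H (stretch J x N) by exact: (cvgr_gt _ HJ).
pose F N := exceed coord [set: 'I_n]%SET (stretch J x (N + N0)%N).
have vF N : v (F N) = (- ln (H (stretch J x (N + N0)%N)))%:E.
  have := exp_measure_exceedT (spos (N + N0)%N); rewrite -/(F N).
  have HN : 0 < H (stretch J x (N + N0)%N) by apply: Hpos; rewrite /= leq_addl.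
  (* An infinite mass would give [H] the value [expeR -oo = 0], against [HN]. *)
  case: (v (F N)) (measure_ge0 v (F N)) => [r _ /= [->]| _ /= [Hx] |//].
    by rewrite expRK opprK.
  by rewrite Hx ltxx in HN.
have Fcap : exceed coord J x `|` [set y | exists2 i, i \in ~: J & tnth y i = +oo%E] =
    \bigcap_N F N.
  apply/seteqP; split => y /=.
    move=> [[i iJ xy]|[i iJ yi]] N _; exists i; rewrite ?inE// tnth_mktuple.
      by rewrite iJ.
    by move: iJ; rewrite inE => /negbTE ->; rewrite yi ltry.
  move=> Hy; apply: contrapT => /not_orP[nJ noo].
  (* This [N] bounds all finite coordinates of [y] at once. A coordinate equal to [-oo] is below
     every level anyway. *)
  pose N := Num.truncn (\sum_i `|fine (tnth y i)|).
  have [i _] := Hy N I; rewrite tnth_mktuple; case: ifPn => iJ xy; first by apply: nJ; exists i.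
  apply/negP: xy; rewrite -leNgt.
  have : tnth y i != +oo%E by apply/eqP => yi; apply: noo; exists i; rewrite ?inE.
  have : `|fine (tnth y i)| <= (N + N0).+1%:R.
    apply: (@le_trans _ _ N.+1%:R); last by rewrite ler_nat ltnS leq_addr.
    apply: ltW; apply: le_lt_trans (truncnS_gt _).
    by rewrite (bigD1 i)//= lerDl sumr_ge0.
  case: (tnth y i) => [r rN _|//|_ _]; last by rewrite leNye.
  by rewrite lee_fin (le_trans (ler_norm _)).
have vFcap : v \o F @ \oo --> v (\bigcap_N F N).
  apply: nonincreasing_cvg_mu.
  - by rewrite vF ltry.
  - by move=> N; exact: measurable_exceed_coord.
  - by apply: bigcapT_measurable => N; exact: measurable_exceed_coord.
  - move=> N M NM; rewrite subsetEset => y [i _]; rewrite tnth_mktuple => xy.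
    exists i; rewrite ?inE// tnth_mktuple; apply: le_lt_trans xy.
    by case: ifP => // _; rewrite lee_fin ler_nat ltnS leq_add2r.
rewrite Fcap -(cvg_lim _ vFcap)//; apply: cvg_lim => //.
rewrite (_ : v \o F = EFin \o (fun N => - ln (H (stretch J x (N + N0)%N)))); last first.
  by apply/funext => N /=; rewrite vF.
apply: cvg_EFin; first exact: nearW.
rewrite [X in X @ _](_ : _ = fun N => - ln (H (stretch J x (N + N0)%N)))//.
have HJ' : H (stretch J x (N + N0)%N) @[N --> \oo] --> partial_df P J x.
  by have := HJ; rewrite -(cvg_shiftn N0).
by apply: cvgN; apply: (@cvg_comp _ _ _ _ (@ln R)); [exact: HJ'|exact: continuous_ln].
Qed.

Lemma partial_df_set1 (Q : probability (n.-tuple R) R) (i : 'I_n) (x : n.-tuple R) :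
  frechet_margins Q -> 0 < tnth x i -> partial_df Q [set i]%SET x = expR (- (tnth x i)^-1).
Proof.
move=> QF xi0; have -> : expR (- (tnth x i)^-1) = frechet (tnth x i) by rewrite /frechet xi0.
apply: EFin_inj; rewrite -partial_dfE -(QF i); congr (Q _).
apply/seteqP; split => y /=; first by apply; rewrite inE.
by move=> yx j; rewrite inE => /eqP ->.
Qed.

(** An infinite coordinate exceeds every level [t], so the mass is at most [1 / t]; the level
    [t = 1 / e] gives the bound [e]. Positivity of the marginal for a singleton is read off the
    Fréchet df. *)
Lemma exp_measure_infty (i : 'I_n) : v [set y | tnth y i = +oo%E] = 0%E.
Proof.
apply/eqP; rewrite eq_le measure_ge0 andbT.
apply/lee_addgt0Pr => e e0; rewrite add0e.
pose x : n.-tuple R := [tuple e^-1 | _ < n].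
have x0 : posR x by move=> j; rewrite tnth_mktuple invr_gt0.
have b := partial_df_set1 P_frechet (x0 i).
have := @exceed_or_infty [set i]%SET x x0; rewrite b expR_gt0 expRK opprK tnth_mktuple invrK.
move=> /(_ isT) <-; apply: le_measure; rewrite ?inE.
- exact: measurable_eqy.
- apply: measurableU; first exact: measurable_exceed_coord.
  by apply: (@measurable_exists_in _ _ _ (fun i => [set y | tnth y i = +oo%E])) => j;
    exact: measurable_eqy.
- by move=> y /= yi; left; exists i; rewrite ?inE// yi ltry.
Qed.

Let exp_measure_pos (J : {set 'I_n}) (x : n.-tuple R) : posR x -> 0 < partial_df P J x ->
  v (exceed coord J x) = (- ln (partial_df P J x))%:E.
Proof.
move=> x0 b0; rewrite -exceed_or_infty// measureU0//.
- exact: measurable_exceed_coord.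
- by apply: (@measurable_exists_in _ _ _ (fun i => [set y | tnth y i = +oo%E])) => j;
    exact: measurable_eqy.
- apply/eqP; rewrite eq_le measure_ge0 andbT.
  apply: (le_trans (@measure_exists_in_le _ _ _ v _ (fun i => [set y | tnth y i = +oo%E]) _ _)).
    by move=> i; exact: measurable_eqy.
  by rewrite big1// => i _; exact: exp_measure_infty.
Qed.

Lemma exp_measure_tail (i : 'I_n) (t : R) : 0 < t ->
  v [set y | (t%:E < tnth y i)%E] = (t^-1)%:E.
Proof.
move=> t0; pose x : n.-tuple R := [tuple t | _ < n].
have x0 : posR x by move=> j; rewrite tnth_mktuple.
have b := partial_df_set1 P_frechet (x0 i).
have := @exp_measure_pos [set i]%SET x x0; rewrite b expR_gt0 expRK opprK tnth_mktuple.
move=> /(_ isT) <-; congr (v _); apply/seteqP; split => y /=.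
  by move=> ty; exists i; rewrite ?inE// tnth_mktuple.
by move=> [j]; rewrite inE => /eqP ->; rewrite tnth_mktuple.
Qed.

Let exceed_le (J : {set 'I_n}) (x : n.-tuple R) : posR x ->
  (v (exceed coord J x) <= (\sum_i (tnth x i)^-1)%:E)%E.
Proof.
move=> x0; apply: (le_trans (@measure_exists_in_le _ _ _ v _
  (fun i => [set y : n.-tuple (\bar R) | ((tnth x i)%:E < tnth y i)%E]) _ _)).
  by move=> i; apply: measurable_lt_cst; exact: measurable_tnth.
rewrite -sumEFin big_mkcond /=; apply: lee_sum => i _; case: ifP => _.
  by rewrite exp_measure_tail.
by rewrite lee_fin invr_ge0 ltW.
Qed.

(** The Fréchet margins give the tails [1 / t] of single coordinates. By subadditivity the
    exceedance set has mass at most [\sum_i 1 / x_i], so [H x] is the exponential of a finite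
    number, and [partial_df] can only grow when [J] shrinks. This discharges the positivity
    hypothesis of [exp_measure_pos]. *)
Lemma partial_df_gt0 (J : {set 'I_n}) (x : n.-tuple R) : posR x -> 0 < partial_df P J x.
Proof.
move=> x0; apply: lt_le_trans (partial_dfS P x (finset.subsetT J)).
rewrite (partial_df_setT _ PH) -lte_fin exp_measure_exceedT// expeR_gt0// lteNr /=.
exact: le_lt_trans (exceed_le _ x0) (ltry _).
Qed.

Lemma exp_measure_exceed (J : {set 'I_n}) (x : n.-tuple R) : posR x ->
  v (exceed coord J x) = (- ln (partial_df P J x))%:E.
Proof. by move=> x0; rewrite exp_measure_pos//; exact: partial_df_gt0. Qed.

Lemma Nln_partial_df_le (J : {set 'I_n}) (x : n.-tuple R) : posR x ->
  - ln (partial_df P J x) <= \sum_i (tnth x i)^-1.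
Proof. by move=> x0; rewrite -lee_fin -exp_measure_exceed//; exact: exceed_le. Qed.

Lemma exp_measure_no_atom (i : 'I_n) (t : R) : 0 < t -> v [set y | tnth y i = t%:E] = 0%E.
Proof.
move=> t0; apply: (@continuous_tail_no_atom _ _ _ v _ (@GRing.inv R)) => //.
- exact: measurable_tnth.
- by apply: inv_continuous; rewrite gt_eqF.
- by move=> s s0; exact: exp_measure_tail.
Qed.

(** Required for Tonelli. A point of [Eset] has a positive coordinate, which exceeds [1 / N.+1] for
    some [N]; the null complement of [Eset] is added to each covering set. *)
Lemma exp_measure_sigma_finite : sigma_finite setT v.
Proof.
pose x N : n.-tuple R := [tuple N.+1%:R^-1 | _ < n].
pose F N : set (n.-tuple (\bar R)) := ~` @Eset R n `|` exceed coord [set: 'I_n]%SET (x N).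
exists F; last first.
  move=> N; split.
    by apply: measurableU; [apply: measurableC; exact: measurable_Eset|
      exact: measurable_exceed_coord].
  have : (v (F N) <= v (~` @Eset R n) + v (exceed coord [set: 'I_n]%SET (x N)))%E.
    apply: measureU2; first by apply: measurableC; exact: measurable_Eset.
    exact: measurable_exceed_coord.
  move=> /le_lt_trans; apply; case: vH => -> _; rewrite add0e exp_measure_exceed ?ltry// => i.
  by rewrite tnth_mktuple invr_gt0.
apply/esym; rewrite -subTset => y _.
have [[y0 [i yi]]|nE] := pselect (@Eset R n y); last by exists 0%N => //; left.
have {}yi : (0 < tnth y i)%E by rewrite lt_neqAle eq_sym yi y0.
have [N yN] : exists N : nat, ((N.+1%:R^-1)%:E < tnth y i)%E.
  case: (tnth y i) yi => [r| |//]; last by exists 0%N; rewrite ltry.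
  rewrite lte_fin => r0; exists (Num.truncn r^-1); rewrite lte_fin.
  by rewrite -[ltRHS]invrK ltf_pV2 ?posrE ?invr_gt0// truncnS_gt.
by exists N => //; right; exists i; rewrite ?inE// tnth_mktuple.
Qed.

End exponent_measure.

(** * Limits of roots and expectations under Fréchet margins *)

Lemma measure_eq_mod_null d (T : measurableType d) (R : realType)
    (m : {measure set T -> \bar R}) (A B N : set T) :
  measurable A -> measurable B -> measurable N -> m N = 0%E -> A `|` N = B `|` N -> m A = m B.
Proof. by move=> mA mB mN N0 AB; rewrite -(measureU0 mA mN N0) AB measureU0. Qed.

Lemma measurable_partial_df (R : realType) n (P : probability (n.-tuple R) R) (J : {set 'I_n}) :
  measurable_fun setT (partial_df P J).
Proof.
pose dom := [set zy : n.-tuple R * n.-tuple R | forall i, i \in J -> tnth zy.2 i <= tnth zy.1 i].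
have mdom : measurable dom.
  apply: (@measurable_forall_in _ _ _ (fun i =>
    [set zy : n.-tuple R * n.-tuple R | tnth zy.2 i <= tnth zy.1 i])) => i.
  rewrite (_ : mkset _ = [set zy : n.-tuple R * n.-tuple R |
    ((tnth zy.2 i)%:E <= (tnth zy.1 i)%:E)%E])//.
  rewrite -[X in measurable X]setTI; apply: measurable_lee => //; apply/measurable_EFinP;
    apply: (@measurableT_comp _ _ _ _ _ _ (fun z => tnth z i)) => //; exact: measurable_tnth.
rewrite (_ : partial_df P J = fine \o (P \o xsection dom)).
  by apply: measurableT_comp => //; exact: measurable_fun_xsection.
apply/funext => z /=; congr (fine (P _)).
by apply/seteqP; split => y /=; rewrite /xsection /= inE.
Qed.

(** This is [1 + u <= expR u] at [u = ln b / N.+1]. It serves as the domination. *)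
Lemma mul_one_sub_root_le (R : realType) (b : R) (N : nat) : 0 < b ->
  N.+1%:R * (1 - b `^ N.+1%:R^-1) <= - ln b.
Proof.
move=> b0; rewrite /powR gt_eqF// -ler_pdivlMl// lerBlDr -lerBlDl mulrN opprK.
exact: expR_ge1Dx.
Qed.

(** With [c = - ln b], the sequence lies between [c / (1 + c / N.+1)] and [c]; the lower bound is
    [1 + u <= expR u] at [u = c / N.+1], inverted. *)
Lemma cvg_mul_one_sub_root (R : realType) (b : R) : 0 < b -> b <= 1 ->
  N.+1%:R * (1 - b `^ N.+1%:R^-1) @[N --> \oo] --> - ln b.
Proof.
move=> b0 b1; pose c := - ln b; have c0 : 0 <= c by rewrite oppr_ge0 ln_le0.
have den0 N : 0 < 1 + N.+1%:R^-1 * c by rewrite ltr_pwDl// mulr_ge0.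
apply: (@squeeze_cvgr _ _ _ _ (fun N : nat => c / (1 + N.+1%:R^-1 * c)) (fun=> - ln b)).
- near=> N; rewrite mul_one_sub_root_le// andbT.
  have eb : b `^ N.+1%:R^-1 <= (1 + N.+1%:R^-1 * c)^-1.
    rewrite /powR gt_eqF// -[leLHS]invrK -expRN lef_pV2 ?posrE ?expR_gt0//.
    by rewrite -mulrN; exact: expR_ge1Dx.
  apply: (@le_trans _ _ (N.+1%:R * (1 - (1 + N.+1%:R^-1 * c)^-1))).
    rewrite le_eqVlt; apply/orP; left; apply/eqP.
    have d0 := lt0r_neq0 (den0 N); apply: (mulIf d0).
    by rewrite mulfVK// -mulrA mulrBl mul1r mulVf// addrAC subrr add0r mulrA mulfV// mul1r.
  by rewrite ler_wpM2l// lerB.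
- rewrite -[X in _ --> X]/c -[X in _ --> X]divr1; apply: cvgMr; apply: cvgV => //.
  rewrite -[X in _ --> X]addr0; apply: cvgD; first exact: cvg_cst.
  by rewrite -(mul0r c); apply: cvgMl; exact: cvg_harmonic.
- exact: cvg_cst.
Unshelve. all: by end_near. Qed.

Section frechet_expectations.
Context (R : realType) (n : nat) (Q : probability (n.-tuple R) R).
Hypothesis Q_frechet : frechet_margins Q.

Lemma frechet_margins_le0 (i : 'I_n) : Q [set y | tnth y i <= 0] = 0%E.
Proof. by rewrite Q_frechet /frechet ltxx. Qed.

Lemma frechet_margins_pos : Q (~` @posR R n) = 0%E.
Proof.
apply/eqP; rewrite eq_le measure_ge0 andbT.
rewrite (_ : ~` _ = [set y | exists2 i, i \in [set: 'I_n]%SET & [set y | tnth y i <= 0] y]).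
  apply: (le_trans (measure_exists_in_le _ _ _)).
    by move=> i; exact: measurable_tnth_le.
  by rewrite big1// => i _; exact: frechet_margins_le0.
apply/seteqP; split => y /=.
  by move=> /existsNP[i /negP]; rewrite -leNgt; exists i; rewrite ?inE.
by move=> [i _ yi] /(_ i); rewrite ltNge yi.
Qed.

Lemma frechet_margins_no_atom (i : 'I_n) (t : R) : 0 < t -> Q [set y | tnth y i = t] = 0%E.
Proof.
move=> t0; rewrite (_ : mkset _ = [set y : n.-tuple R | (tnth y i)%:E = t%:E]); last first.
  by apply/seteqP; split => y /= [->].
apply: (@continuous_tail_no_atom _ _ _ Q _ (fun t => 1 - expR (- t^-1))) => //.
- by apply/measurable_EFinP; exact: measurable_tnth.
- apply: cvgB; first exact: cvg_cst.
  apply: (@cvg_comp _ _ _ _ expR); last exact: continuous_expR.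
  by apply: cvgN; apply: inv_continuous; rewrite gt_eqF.
- move=> s s0; transitivity (Q (~` [set y : n.-tuple R | tnth y i <= s])).
    by congr (Q _); apply/seteqP; split => y /=; rewrite lte_fin ltNge => /negP.
  by rewrite probability_setC ?Q_frechet /frechet ?s0//; exact: measurable_tnth_le.
Qed.

(* Nonnegative everywhere, and equal to the inverse on the almost sure event [0 < tnth y i]. *)
Let inv_coord (i : 'I_n) (y : n.-tuple R) := tnth y i `^ (-1).

Let inv_coordE (i : 'I_n) (y : n.-tuple R) : 0 < tnth y i -> inv_coord i y = (tnth y i)^-1.
Proof. by move=> y0; rewrite /inv_coord powR_inv1// ltW. Qed.

Let measurable_inv_coord (i : 'I_n) : measurable_fun setT (inv_coord i).
Proof.
apply: (@measurableT_comp _ _ _ _ _ _ (fun t => t `^ (-1))); last exact: measurable_tnth.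
exact: measurable_powR.
Qed.

Let measurable_inv_coord_gt (i : 'I_n) (r : R) : measurable [set y | r < inv_coord i y].
Proof.
rewrite (_ : mkset _ = [set y | (r%:E < (inv_coord i y)%:E)%E])//.
by apply: measurable_lt_cst; apply/measurable_EFinP.
Qed.

(** Up to the null events [tnth y i <= 0] and [tnth y i = r^-1], the event is [tnth y i <= r^-1],
    whose Fréchet probability is [expR (- r)]. At [r = 0] it is almost surely everything. *)
Let inv_coord_tail (i : 'I_n) (r : R) : 0 <= r ->
  Q [set y | r < inv_coord i y] = (expR (- r))%:E.
Proof.
have mle0 : measurable [set y : n.-tuple R | tnth y i <= 0] by exact: measurable_tnth_le.
rewrite le_eqVlt => /predU1P[<-|r0].
  rewrite oppr0 expR0 -(@probability_setT _ _ _ Q).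
  apply: (@measure_eq_mod_null _ _ _ Q _ _ _ _ _ mle0 (frechet_margins_le0 i)) => //.
  rewrite setTU -subTset => y _ /=; have [|y0] := leP (tnth y i) 0; [by right|left].
  by rewrite inv_coordE// invr_gt0.
have s0 : 0 < r^-1 by rewrite invr_gt0.
have meq : measurable [set y : n.-tuple R | tnth y i = r^-1].
  rewrite (_ : mkset _ = [set y : n.-tuple R | (tnth y i)%:E = (r^-1)%:E]).
    by apply: measurable_eq_cst; apply/measurable_EFinP; exact: measurable_tnth.
  by apply/seteqP; split => y /= [->].
rewrite -[r in RHS]invrK.
rewrite [RHS](_ : _ = Q [set y | tnth y i <= r^-1]); last by rewrite Q_frechet /frechet s0.
apply: (@measure_eq_mod_null _ _ _ Q _ _
    ([set y | tnth y i <= 0] `|` [set y | tnth y i = r^-1])) => //.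
- exact: measurable_tnth_le.
- exact: measurableU.
- have eq0 := frechet_margins_no_atom i s0.
  by transitivity (Q [set y | tnth y i <= 0]); [exact: measureU0|exact: frechet_margins_le0].
apply/seteqP; split => y /=; have [y0|y0] := leP (tnth y i) 0; try by right; left.
  rewrite inv_coordE// => -[ry|?]; [left|by right].
  by rewrite ltW// -ltf_pV2 ?posrE// invrK.
move=> [|?]; [rewrite le_eqVlt|by right].
move=> /predU1P[->|ys]; first by right; right.
by left; rewrite inv_coordE// -[r]invrK ltf_pV2 ?posrE.
Qed.

(** The expectation of a nonnegative variable is the integral of its tail, and the tail [expR (- r)]
    is also the density of the standard exponential law, of total mass 1. *)
Let expectation_inv_coord (i : 'I_n) : (\int[Q]_y (inv_coord i y)%:E = 1)%E.
Proof.
pose X : {RV Q >-> R} := HB.pack (inv_coord i)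
  (isMeasurableFun.Build _ _ _ _ _ (measurable_inv_coord i)).
have X0 y : 0 <= X y by exact: powR_ge0.
have := @ge0_expectation_ccdf _ _ _ Q X X0.
rewrite expectation_def => ->.
rewrite -(@integral_exponential_pdf R 1)// [LHS](_ : _ =
  \int[lebesgue_measure]_(x in `[0%R, +oo[) (expR (- x))%:E)%E; last first.
  apply: eq_integral => r; rewrite inE/= in_itv/= andbT => r0.
  rewrite -(inv_coord_tail i)// /ccdf /distribution /pushforward; congr (Q _).
  by apply/seteqP; split => y /=; rewrite in_itv/= andbT.
rewrite integral_mkcond; apply: eq_integral => r _.
rewrite /exponential_pdf !patchE; case: ifP => //= _.
by rewrite mul1r mulN1r.
Qed.

Lemma expectation_inv_frechet (i : 'I_n) (f : n.-tuple R -> R) : measurable_fun setT f ->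
  (forall y, posR y -> f y = (tnth y i)^-1) -> (\int[Q]_y (f y)%:E = 1)%E.
Proof.
move=> mf fE; rewrite -(expectation_inv_coord i); apply: ae_eq_integral => //.
- exact/measurable_EFinP.
- exact/measurable_EFinP.
- exists (~` @posR R n); split.
  + by apply: measurableC; exact: measurable_posR.
  + exact: frechet_margins_pos.
  + by apply: subsetCl => y /contrapT y0 _ /=; rewrite fE// inv_coordE.
Qed.

Section convergence.
Context (b : n.-tuple R -> R).
Hypothesis mb : measurable_fun setT b.
Hypothesis b_gt0 : forall z, posR z -> 0 < b z.
Hypothesis b_le1 : forall z, b z <= 1.
Hypothesis b_dom : forall z, posR z -> - ln (b z) <= \sum_i (tnth z i)^-1.

(** Dominated convergence with majorant the sum of the [inv_coord i], each of integral 1. The bounds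
    hold at positive vectors, hence almost surely. *)
Lemma root_dominated_convergence :
  Q.-integrable setT (fun z => (- ln (b z))%:E) /\
  (\int[Q]_z (N.+1%:R * (1 - b z `^ N.+1%:R^-1))%:E)%E @[N --> \oo] -->
  (\int[Q]_z (- ln (b z))%:E)%E.
Proof.
have ae_pos (E : set (n.-tuple R)) : (forall z, posR z -> E z) -> {ae Q, forall z, E z}.
  move=> Epos; exists (~` @posR R n); split.
  + by apply: measurableC; exact: measurable_posR.
  + exact: frechet_margins_pos.
  + by apply: subsetC => z; exact: Epos.
have [] // := @dominated_convergence _ _ _ Q setT measurableT
  (fun N z => (N.+1%:R * (1 - b z `^ N.+1%:R^-1))%:E) (fun z => (- ln (b z))%:E)
  (fun z => (\sum_i inv_coord i z)%:E).
- move=> N; apply/measurable_EFinP; apply: measurable_funM => //.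
  apply: measurable_funB => //.
  by apply: (@measurableT_comp _ _ _ _ _ _ (fun t => t `^ _)) => //; exact: measurable_powR.
- apply/measurable_EFinP; apply: measurableT_comp => //; exact: measurableT_comp.
- apply: ae_pos => z z0 _; apply: cvg_EFin; first exact: nearW.
  by apply: cvg_mul_one_sub_root; [exact: b_gt0|exact: b_le1].
- under eq_fun do rewrite -sumEFin; apply: integrable_sum => // i _.
  apply/integrableP; split; first exact/measurable_EFinP.
  under eq_integral do rewrite gee0_abs ?lee_fin ?powR_ge0//.
  by rewrite expectation_inv_coord ltry.
- apply: ae_pos => z z0 N _; rewrite /= lee_fin ger0_norm.
    apply: (le_trans (mul_one_sub_root_le _ (b_gt0 z0))); apply: (le_trans (b_dom z0)).
    by apply: ler_sum => i _; rewrite inv_coordE.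
  apply: mulr_ge0 => //; rewrite subr_ge0 /powR gt_eqF ?b_gt0//.
  by rewrite -expR0 ler_expR mulr_ge0_le0// ln_le0.
Qed.

End convergence.

End frechet_expectations.

(** * Alternating sums over subsets *)

(** After exchanging the sums, each [f J] is multiplied by the signed count of the supersets of [J],
    which vanishes unless [J] is the full set. *)
Lemma moebius_subsets (R : comPzRingType) (I : finType) (f : {set I} -> R) :
  \sum_(K : {set I}) (-1) ^+ #|K|.+1 * (\sum_(J : {set I} | J \subset K) (-1) ^+ #|J|.+1 * f J) =
  f [set: I]%SET.
Proof.
pose e := (-1) ^+ #|I| : R.
have inner (J : {set I}) :
    \sum_(K : {set I} | J \subset K) (-1) ^+ #|K| = if J == [set: I]%SET then e else 0 :> R.
  (* Passing to complements turns supersets of [J] into sets disjoint from [J], with [e] accounting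
     for the change of parity. Disjointness is written as a product of indicators so that
     [sum_prod_opp_subset] applies. *)
  transitivity (e * \sum_(K : {set I}) (-1) ^+ #|K| * \prod_(i in K) (i \notin J)%:R : R).
    rewrite big_distrr/= big_mkcond/= (reindex_inj (@finset.setC_inj _))/=.
    apply: eq_bigr => K _; case: ifPn => JK.
      rewrite big1 => [|i iK]; last first.
        move: JK; rewrite -finset.disjoints_subset => JK.
        by rewrite (contraTN _ iK)// => iJ; rewrite (disjointFr JK iJ).
      rewrite mulr1 cardsCs finset.setCK /e.
      have -> : #|I| = (#|K| + (#|I| - #|K|))%N by rewrite subnKC// max_card.
      by rewrite exprD mulrAC -expr2 sqrr_sign mul1r addKn.
    have /fintype.subsetPn[i iJ] := JK; rewrite inE negbK => iK.
    by rewrite (bigD1 i)//= iJ mul0r mulr0 mulr0.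
  rewrite sum_prod_opp_subset; case: eqP => [->|/eqP JT].
    by rewrite big1 ?mulr1// => i _; rewrite inE subr0.
  have /fintype.subsetPn[i _ iJ] : ~~ ([set: I]%SET \subset J) by rewrite finset.subTset.
  by rewrite (bigD1 i)//= iJ subrr mul0r mulr0.
under eq_bigr do rewrite big_distrr/=.
rewrite (exchange_big_dep predT)//=.
transitivity (\sum_(J : {set I}) (-1) ^+ #|J| * f J * (if J == [set: I]%SET then e else 0)).
  apply: eq_bigr => J _; rewrite -inner big_distrr/=; apply: eq_bigr => K _.
  by rewrite !exprS !mulN1r mulNr mulNr mulrN opprK mulrC.
rewrite (bigD1 [set: I]%SET)//= eqxx big1 ?addr0 => [|J /negbTE ->]; last by rewrite mulr0.
by rewrite mulrAC cardsT /e -expr2 sqrr_sign mul1r.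
Qed.

(** The singletons, with sign plus, account for the leading [n], and the empty set contributes
    nothing. *)
Lemma sum_sets_card_ge2 (R : pzRingType) n (f : {set 'I_n} -> R) :
  f finset.set0 = 0 -> (forall i, f [set i]%SET = 1) ->
  \sum_(J : {set 'I_n}) (-1) ^+ #|J|.+1 * f J =
  n%:R + \sum_(J : {set 'I_n} | (2 <= #|J|)%N) (-1) ^+ #|J|.+1 * f J.
Proof.
move=> f0 f1; rewrite (bigID (fun J : {set 'I_n} => (2 <= #|J|)%N))/= addrC; congr (_ + _).
rewrite (bigID (fun J : {set 'I_n} => #|J| == 1%N))/= [X in _ + X]big1 ?addr0; last first.
  move=> J; rewrite -ltnNge ltnS leq_eqVlt => /andP[/orP[->//|]].
  by rewrite ltnS leqn0 cards_eq0 => /eqP -> _; rewrite f0 mulr0.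
transitivity (\sum_(J in [set [set i]%SET | i : 'I_n]) (1 : R)); last first.
  rewrite sumr_const card_imset ?card_ord//; exact: finset.set1_inj.
apply: eq_big => [J|J /andP[_ /cards1P[i ->]]]; last by rewrite cards1 f1 mulr1 expr2 mulrNN mulr1.
apply/andP/imsetP => [[_ /cards1P[i ->]]|[i _ ->]]; first by exists i.
by rewrite cards1.
Qed.

(** * Integrals against the exponent measure and the laws of powers *)

Section sigma_finite_alias.
Context d (T : measurableType d) (R : realType) (m : {measure set T -> \bar R}).

(** A copy of [m] that carries the proof [sf] in its name, so that the sigma-finite structure can be
    attached to an exponent measure given only as a measure. *)
Definition sigma_finite_alias (sf : sigma_finite setT m) : set T -> \bar R := m.

Variable sf : sigma_finite setT m.

HB.instance Definition _ := isMeasure.Build _ _ _ (sigma_finite_alias sf)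
  (measure0 m) (measure_ge0 m) (@measure_semi_sigma_additive _ _ _ m).

HB.instance Definition _ := Measure_isSigmaFinite.Build _ _ _ (sigma_finite_alias sf) sf.

End sigma_finite_alias.

Lemma measurable_posE (R : realType) n : measurable (@Defs.posE R n).
Proof.
apply: (@measurable_forall _ _ _ (fun i => [set y : n.-tuple (\bar R) |
  (0%E < tnth y i < +oo)%E])) => i.
rewrite (_ : mkset _ = [set y : n.-tuple (\bar R) | (0%E < tnth y i)%E] `&`
  [set y | (tnth y i < +oo)%E]).
  apply: measurableI; first by apply: measurable_lt_cst; exact: measurable_tnth.
  rewrite -[X in measurable X]setTI.
  by apply: emeasurable_fun_infty_o => //; exact: measurable_tnth.
by apply/seteqP; split => y /= /andP.
Qed.

(** On [posE] the integrand is [Q], written as a probability. Outside it, and off the null set of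
    infinite coordinates, some coordinate of [y] is at most 0, and Fréchet margins give probability
    0 to lying below such a [y]. *)
Lemma lamQH_tonelli (R : realType) (n : nat) (PQ : probability (n.-tuple R) R)
    (Q : n.-tuple R -> R) (v : {measure set (n.-tuple (\bar R)) -> \bar R}) :
  is_df_of PQ Q -> frechet_margins PQ -> (forall i, v [set y | tnth y i = +oo%E] = 0%E) ->
  lamQH Q v = (\int[v]_y PQ [set z | forall i, ((tnth z i)%:E <= tnth y i)%E])%E.
Proof.
move=> PQQ PQF v_infty.
pose g (y : n.-tuple (\bar R)) := PQ [set z | forall i, ((tnth z i)%:E <= tnth y i)%E].
have mg : measurable_fun setT g.
  by apply: measurable_prob_le => i; exact: measurable_tnth.
have mpE := @measurable_posE R n.
transitivity (\int[v]_(y in @Defs.posE R n) g y)%E.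
  apply: eq_integral => y; rewrite inE => yE; rewrite -PQQ; congr (PQ _).
  have fineE i : tnth y i = (tnth (map_tuple fine y) i)%:E.
    rewrite tnth_map fineK//; move: (yE i) => /andP[y0 yoo].
    by rewrite ge0_fin_numE// ltW.
  by apply/seteqP; split => z zy i; move: (zy i); rewrite /= fineE lee_fin.
rewrite integral_mkcond; apply: ae_eq_integral => //.
  by apply/(measurable_restrictT _ mpE); exact: measurable_funTS.
pose N := [set y : n.-tuple (\bar R) |
  exists2 i, i \in [set: 'I_n]%SET & [set y | tnth y i = +oo%E] y].
exists N; split.
- by apply: measurable_exists_in => i; exact: measurable_eqy.
- apply/eqP; rewrite eq_le measure_ge0 andbT.
  apply: (le_trans (measure_exists_in_le _ _ _)); first by move=> i; exact: measurable_eqy.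
  by rewrite big1.
apply: subsetCl => y nNy _ /=; rewrite patchE; case: ifPn => //.
rewrite notin_setE => /existsNP[i yi]; apply/esym/eqP; rewrite eq_le measure_ge0 andbT.
apply: le_trans (_ : PQ [set z : n.-tuple R | tnth z i <= 0]%R <= 0)%E; last first.
  by rewrite (frechet_margins_le0 PQF).
apply: le_measure; rewrite ?inE//.
- apply: (@measurable_forall _ _ _ (fun i => [set z : n.-tuple R | ((tnth z i)%:E <= tnth y i)%E])).
  move=> j; rewrite -[X in measurable X]setTI; apply: measurable_lee => //.
  by apply/measurable_EFinP; exact: measurable_tnth.
- exact: measurable_tnth_le.
move=> z /= /(_ i) zy; rewrite -lee_fin; apply: (le_trans zy); rewrite leNgt; apply/negP => y0.
apply: yi; rewrite y0 /= ltey; apply/eqP => yoo; apply: nNy.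
by exists i; rewrite ?inE.
Qed.

Lemma lamQH_inclusion_exclusion (R : realType) (n : nat) (PH PQ : probability (n.-tuple R) R)
    (H Q : n.-tuple R -> R) (v : {measure set (n.-tuple (\bar R)) -> \bar R}) :
  (0 < n)%N -> is_df_of PH H -> frechet_margins PH -> is_df_of PQ Q -> frechet_margins PQ ->
  is_exp_measure H v ->
  (forall J : {set 'I_n}, PQ.-integrable setT (fun z => (- ln (partial_df PH J z))%:E)) ->
  lamQH Q v = (\sum_(J : {set 'I_n}) ((-1) ^+ #|J|.+1)%:E *
    \int[PQ]_z (- ln (partial_df PH J z))%:E)%E.
Proof.
move=> n0 PHH PHF PQQ PQF vH intL.
have sfv : sigma_finite setT v := exp_measure_sigma_finite PHH PHF vH.
rewrite -(@tonelli_inclusion_exclusion _ _ _ (sigma_finite_alias sfv) n (fun i y => tnth y i) PQ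
  (fun J z => - ln (partial_df PH J z))) //.
- by rewrite (lamQH_tonelli PQQ PQF)// => i; exact: (exp_measure_infty PHH PHF vH).
- by move=> i; exact: measurable_tnth.
- exact: frechet_margins_pos.
- by move=> J z z0; exact: (exp_measure_exceed PHH PHF vH).
- by move=> i t t0; exact: (exp_measure_no_atom PHH PHF vH).
Qed.

Lemma integrable_one_sub_root (R : realType) (n : nat) (PH PQ : probability (n.-tuple R) R)
    (r : R) (J : {set 'I_n}) : 0 <= r ->
  PQ.-integrable setT (fun z => (1 - partial_df PH J z `^ r)%:E).
Proof.
move=> r0; have G01 z : 0 <= partial_df PH J z `^ r <= 1.
  rewrite powR_ge0 /powR; case: ifPn => _ /=; first by rewrite lern1 leq_b1.
  by rewrite -expR0 ler_expR mulr_ge0_le0// ln_le0// partial_df_le1.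
have mG : measurable_fun setT (fun z => 1 - partial_df PH J z `^ r).
  apply: measurable_funB => //.
  apply: (@measurableT_comp _ _ _ _ _ _ (fun t => t `^ r)); first exact: measurable_powR.
  exact: measurable_partial_df.
apply: (@le_integrable _ _ _ PQ _ measurableT _ (fun=> 1%E)).
- exact/measurable_EFinP.
- move=> z _; have /andP[? ?] := G01 z.
  by rewrite /= lee_fin normr1 ger0_norm ?subr_ge0// gerBl.
- exact: finite_measure_integrable_cst.
Qed.

Lemma integral_root_inclusion_exclusion (R : realType) (n : nat)
    (PH PQ Pr : probability (n.-tuple R) R) (H Q : n.-tuple R -> R) (r : R) :
  (0 < n)%N -> is_df_of PH H -> frechet_margins PH -> is_df_of PQ Q -> frechet_margins PQ ->
  is_df_of Pr (fun x => H x `^ r) -> 0 <= r ->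
  (forall J z, posR z -> 0 < partial_df PH J z) ->
  (\int[Pr]_x (Q x)%:E = \sum_(J : {set 'I_n}) ((-1) ^+ #|J|.+1)%:E *
    \int[PQ]_z (1 - partial_df PH J z `^ r)%:E)%E.
Proof.
move=> n0 PHH PHF PQQ PQF PrH r0 b0.
rewrite -(@tonelli_inclusion_exclusion _ _ _ Pr n (fun i y => (tnth y i)%:E) PQ
  (fun J z => 1 - partial_df PH J z `^ r)) //.
- by apply: eq_integral => y _; rewrite -PQQ.
- by move=> i; apply/measurable_EFinP; exact: measurable_tnth.
- exact: frechet_margins_pos.
- move=> J z z0; rewrite -(partial_df_pow PHH PrH) ?b0//.
  exact: (@exceed_partial_df _ _ Pr).
- move=> i t t0.
  (* The margins under [Pr] are powers of the Fréchet df, so the tail at [t] is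
     [1 - expR (- r / t)]. *)
  apply: (@continuous_tail_no_atom _ _ _ Pr _ (fun t => 1 - expR (r * - t^-1))) => //.
  + by apply/measurable_EFinP; exact: measurable_tnth.
  + apply: cvgB; first exact: cvg_cst.
    apply: (@cvg_comp _ _ _ _ expR); last exact: continuous_expR.
    by apply: cvgMr; apply: cvgN; apply: inv_continuous; rewrite gt_eqF.
  + move=> s s0; pose x : n.-tuple R := [tuple s | _ < n].
    have x0 : posR x by move=> j; rewrite tnth_mktuple.
    transitivity (Pr (exceed (fun i y => (tnth y i)%:E) [set i]%SET x)).
      congr (Pr _); apply/seteqP; split => y /=.
        by move=> sy; exists i; rewrite ?inE// tnth_mktuple.
      by move=> [j]; rewrite inE => /eqP ->; rewrite tnth_mktuple.
    apply: etrans (@exceed_partial_df _ _ Pr _ _) _.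
    rewrite (partial_df_pow PHH PrH) ?b0// (partial_df_set1 PHF (x0 i)).
    by rewrite /powR gt_eqF ?expR_gt0// expRK tnth_mktuple.
by move=> J; exact: integrable_one_sub_root.
Qed.

(** * Marginal laws and the expansion for subsets of coordinates *)

Section marginals.
Context (R : realType) (d : nat) (K : {set 'I_d}).

Lemma measurable_coordK : measurable_fun setT (@coordK R d K).
Proof.
apply/measurable_fun_tnthP => j.
rewrite (_ : _ \o _ = fun x => tnth x (enum_val j)); first exact: measurable_tnth.
by apply/funext => x /=; rewrite tnth_mktuple.
Qed.

HB.instance Definition _ := isMeasurableFun.Build _ _ _ _ _ measurable_coordK.

Definition marginal (P : probability (d.-tuple R) R) : probability (#|K|.-tuple R) R :=
  distribution P (coordK K).

Lemma marginal_df P : is_df_of (marginal P) (margdf P K).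
Proof.
move=> z; rewrite /margdf fineK.
  by congr (P _); apply/seteqP; split => y /= Hy j; move: (Hy j); rewrite tnth_mktuple.
rewrite fin_num_measure//.
apply: (@measurable_forall _ _ _ (fun j : 'I_#|K| =>
  [set y : d.-tuple R | tnth y (enum_val j) <= tnth z j])) => j.
exact: measurable_tnth_le.
Qed.

Lemma marginal_frechet P : frechet_margins P -> frechet_margins (marginal P).
Proof.
move=> PF j t; rewrite -(PF (enum_val j)); congr (P _).
by apply/seteqP; split => y /=; rewrite tnth_mktuple.
Qed.

Lemma partial_df_marginal P (J : {set 'I_#|K|}) (z : d.-tuple R) :
  partial_df (marginal P) J (coordK K z) = partial_df P [set enum_val j | j in J]%SET z.
Proof.
congr (fine (P _)); apply/seteqP; split => y /= Hy.
  by move=> i /imsetP[j jJ ->]; have := Hy j jJ; rewrite !tnth_mktuple.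
by move=> j jJ; rewrite !tnth_mktuple; apply: Hy; exact: imset_f.
Qed.

Lemma margdf_coordK P (z : d.-tuple R) : margdf P K (coordK K z) = partial_df P K z.
Proof.
congr (fine (P _)); apply/seteqP; split => y /= Hy i.
  move=> iK; have := Hy (enum_rank_in iK i).
  by rewrite tnth_mktuple enum_rankK_in.
by rewrite tnth_mktuple; apply: Hy; exact: enum_valP.
Qed.

(** [enum_val] is injective with image [K], so taking images matches sets of positions with subsets
    of [K]; the inverse is the preimage. *)
Lemma sum_subset_marginal (V : nmodType) (F : {set 'I_d} -> V) :
  \sum_(J : {set 'I_d} | J \subset K) F J =
  \sum_(J : {set 'I_#|K|}) F [set enum_val j | j in J]%SET.
Proof.
rewrite (reindex_onto (fun J : {set 'I_#|K|} => [set enum_val j | j in J]%SET)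
  (fun J => [set j | enum_val j \in J]%SET)) /=.
  apply: eq_bigl => J; rewrite -[RHS]andbT; congr (_ && _).
    by apply/fintype.subsetP => i /imsetP[j _ ->]; exact: enum_valP.
  apply/eqP/setP => j; rewrite inE mem_imset//; exact: enum_val_inj.
move=> J /fintype.subsetP JK; apply/setP => i; apply/imsetP/idP => [[j]|iJ].
  by rewrite inE => jJ ->.
by exists (enum_rank_in (JK _ iJ) i); rewrite ?inE enum_rankK_in// JK.
Qed.

End marginals.

(** The expansion for the full index set is applied to the laws of the coordinates in [K], and its
    integrals are carried back to [PQ] by change of variables. *)
Lemma lamQH_marginal (R : realType) (d : nat) (PH PQ : probability (d.-tuple R) R)
    (K : {set 'I_d}) (v : {measure set (#|K|.-tuple (\bar R)) -> \bar R}) :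
  (0 < #|K|)%N -> frechet_margins PH -> frechet_margins PQ -> is_exp_measure (margdf PH K) v ->
  (forall J : {set 'I_d}, PQ.-integrable setT (fun z => (- ln (partial_df PH J z))%:E)) ->
  lamQH (margdf PQ K) v = (\sum_(J : {set 'I_d} | J \subset K) ((-1) ^+ #|J|.+1)%:E *
    \int[PQ]_z (- ln (partial_df PH J z))%:E)%E.
Proof.
move=> K0 PHF PQF vH intL.
have int_marg (J : {set 'I_#|K|}) :
    (\int[marginal K PQ]_z (- ln (partial_df (marginal K PH) J z))%:E =
     \int[PQ]_z (- ln (partial_df PH [set enum_val j | j in J]%SET z))%:E)%E.
  rewrite ge0_integral_distribution//.
  - by apply: eq_integral => z _ /=; rewrite partial_df_marginal.
  - apply/measurable_EFinP; apply: measurableT_comp => //.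
    by apply: measurableT_comp; [exact: measurable_ln|exact: measurable_partial_df].
  - by move=> z; rewrite lee_fin oppr_ge0 ln_le0// partial_df_le1.
have L0 (P : probability (#|K|.-tuple R) R) J z : (0 <= (- ln (partial_df P J z))%:E)%E.
  by rewrite lee_fin oppr_ge0 ln_le0// partial_df_le1.
rewrite (lamQH_inclusion_exclusion K0 (@marginal_df _ _ K PH) (marginal_frechet PHF)
  (@marginal_df _ _ K PQ) (marginal_frechet PQF) vH).
  rewrite sum_subset_marginal; apply: eq_bigr => J _.
  by rewrite int_marg card_imset//; exact: enum_val_inj.
move=> J; apply/integrableP; split.
  apply/measurable_EFinP; apply: measurableT_comp => //.
  by apply: measurableT_comp; [exact: measurable_ln|exact: measurable_partial_df].
under eq_integral do rewrite gee0_abs//.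
rewrite int_marg; have /integrableP[_] := intL [set enum_val j | j in J]%SET.
apply: le_lt_trans; rewrite le_eqVlt; apply/orP; left; apply/eqP; apply: eq_integral => z _.
by rewrite gee0_abs// lee_fin oppr_ge0 ln_le0// partial_df_le1.
Qed.

(** * The two limits and the two expansions *)

Unset Implicit Arguments.

Theorem theorem2p1 (R : realType) (d : nat) (d_gt0 : (0 < d)%N)
  (H Q : d.-tuple R -> R)
  (PH PQ : probability (d.-tuple R) R)
  (PHn : nat -> probability (d.-tuple R) R)
  (v : {measure set (d.-tuple (\bar R)) -> \bar R})
  (vK : forall K : {set 'I_d}, {measure set (#|K|.-tuple (\bar R)) -> \bar R}) :
  (* H: max-id df with unit Frechet marginals, PH its probability measure *)
  max_id H -> is_df_of PH H -> frechet_margins PH ->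
  (* Q: df with unit Frechet marginals, PQ its probability measure *)
  is_df_of PQ Q -> frechet_margins PQ ->
  (* PHn n is the probability measure with df H^(1/(n+1)) *)
  (forall n : nat, is_df_of (PHn n) (fun x => H x `^ (n.+1%:R)^-1)) ->
  (* v is the exponent measure of H, vK K that of H_K *)
  is_exp_measure H v ->
  (forall K : {set 'I_d}, is_exp_measure (margdf PH K) (vK K)) ->
  let mu := muHQ PQ H id in
  let lam := lamQH Q v in
  [/\ (fun n : nat => (n.+1%:R)%:E *
          \int[PQ]_x ((1 - H x `^ (n.+1%:R)^-1)%:E))%E @ \oo --> mu,
      (fun n : nat => (n.+1%:R)%:E * \int[PHn n]_x (Q x)%:E)%E @ \oo --> lam,
      mu = (d%:R%:E + \sum_(K : {set 'I_d} | (2 <= #|K|)%N)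
              ((-1) ^+ (#|K|.+1))%R%:E * lamQH (margdf PQ K) (vK K))%E,
      lam = (d%:R%:E + \sum_(K : {set 'I_d} | (2 <= #|K|)%N)
              ((-1) ^+ (#|K|.+1))%R%:E * muHQ PQ (margdf PH K) (coordK K))%E
    & d = 2%N -> mu = (2%:E - lam)%E].
Proof.
move=> _ PHH PHF PQQ PQF PHnH vH vKH mu lam.
have b_gt0 J z : posR z -> 0 < partial_df PH J z by exact: (partial_df_gt0 PHH PHF vH).
have root (J : {set 'I_d}) := root_dominated_convergence PQF (measurable_partial_df PH J)
  (b_gt0 J) (partial_df_le1 PH J) (Nln_partial_df_le PHH PHF vH J).
have intL (J : {set 'I_d}) := (root J).1.
(* [m J] is [mu(H_J,Q_J)] as a real number, finite by integrability, so the combinatorics takes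
   place in [R]. *)
pose m (J : {set 'I_d}) := fine (\int[PQ]_z (- ln (partial_df PH J z))%:E).
have mE (J : {set 'I_d}) : (\int[PQ]_z (- ln (partial_df PH J z))%:E = (m J)%:E)%E.
  by rewrite fineK// (integrable_fin_num measurableT (intL J)).
have muKE (K : {set 'I_d}) : muHQ PQ (margdf PH K) (coordK K) = (m K)%:E.
  by rewrite -mE; apply: eq_integral => z _; rewrite margdf_coordK.
have HE : H = partial_df PH [set: 'I_d]%SET by apply/funext => z; rewrite (partial_df_setT _ PHH).
have muE : mu = (m [set: 'I_d]%SET)%:E by rewrite -mE /mu /muHQ HE.
have m0 : m finset.set0 = 0.
  apply: EFin_inj; rewrite -mE (eq_integral (fun=> 0%E)) ?integral0// => z _.
  rewrite /partial_df (_ : mkset _ = setT) ?probability_setT ?ln1 ?oppr0//.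
  by apply/seteqP; split => // y _ i; rewrite inE.
have m1 (i : 'I_d) : m [set i]%SET = 1.
  apply: EFin_inj; rewrite -mE; apply: (expectation_inv_frechet (i := i) PQF).
    apply: measurableT_comp => //.
    by apply: measurableT_comp; [exact: measurable_ln|exact: measurable_partial_df].
  by move=> y y0; rewrite (partial_df_set1 PHF (y0 i)) expRK opprK.
have lamE : lam = (\sum_(J : {set 'I_d}) (-1) ^+ #|J|.+1 * m J)%:E.
  rewrite /lam (lamQH_inclusion_exclusion d_gt0 PHH PHF PQQ PQF vH)// -sumEFin.
  by apply: eq_bigr => J _; rewrite mE.
have lamKE (K : {set 'I_d}) : (0 < #|K|)%N -> lamQH (margdf PQ K) (vK K) =
    (\sum_(J : {set 'I_d} | J \subset K) (-1) ^+ #|J|.+1 * m J)%:E.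
  move=> K0; rewrite (lamQH_marginal K0 PHF PQF (vKH K))// -sumEFin.
  by apply: eq_bigr => J _; rewrite mE.
have inv_ge0 N : 0 <= (N.+1%:R : R)^-1 by [].
have scale (J : {set 'I_d}) (N : nat) : (N.+1%:R%:E *
    \int[PQ]_z (1 - partial_df PH J z `^ N.+1%:R^-1)%:E =
    \int[PQ]_z (N.+1%:R * (1 - partial_df PH J z `^ N.+1%:R^-1))%:E)%E.
  by rewrite -(integralZl measurableT (integrable_one_sub_root PH PQ J (inv_ge0 N))).
have lam_card2 : lam = (d%:R%:E + \sum_(K : {set 'I_d} | (2 <= #|K|)%N)
    ((-1) ^+ (#|K|.+1))%R%:E * muHQ PQ (margdf PH K) (coordK K))%E.
  rewrite lamE sum_sets_card_ge2// EFinD -sumEFin; congr (_ + _)%E.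
  by apply: eq_bigr => K _; rewrite muKE.
split => //.
- rewrite muE -mE HE (_ : (fun n => _) = (fun n => \int[PQ]_z
    (n.+1%:R * (1 - partial_df PH [set: 'I_d]%SET z `^ n.+1%:R^-1))%:E)%E).
    exact: (root _).2.
  by apply/funext => N; rewrite scale.
(* Both sides are finite signed sums over [J], so the convergence already known for each marginal
   suffices. *)
- rewrite lamE.
  pose a (J : {set 'I_d}) (N : nat) :=
    fine (\int[PQ]_z (1 - partial_df PH J z `^ N.+1%:R^-1)%:E).
  have aE J N : (\int[PQ]_z (1 - partial_df PH J z `^ N.+1%:R^-1)%:E = (a J N)%:E)%E.
    rewrite fineK//.
    exact: (integrable_fin_num measurableT (integrable_one_sub_root PH PQ J (inv_ge0 N))).
  rewrite (_ : (fun n => _) =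
      EFin \o (fun N => \sum_(J : {set 'I_d}) (-1) ^+ #|J|.+1 * (N.+1%:R * a J N))).
    apply: cvg_EFin; first exact: nearW.
    apply: (@cvg_big _ _ _ _ _ (@add_continuous R)) => J _; apply: cvgMr.
    suff : (N.+1%:R * a J N)%:E @[N --> \oo] --> (m J)%:E by move=> /fine_cvgP[_].
    by have := (root J).2; rewrite mE; under eq_fun do rewrite -scale aE.
  apply/funext => N /=.
  rewrite (integral_root_inclusion_exclusion d_gt0 PHH PHF PQQ PQF (PHnH N))//.
  transitivity (N.+1%:R%:E * \sum_(J : {set 'I_d}) ((-1) ^+ #|J|.+1 * a J N)%:E)%E.
    by congr (_ * _)%E; apply: eq_bigr => J _; rewrite EFinM -aE.
  rewrite sumEFin -EFinM big_distrr/=; congr (_%:E).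
  by apply: eq_bigr => J _; rewrite mulrCA.
(* Moebius inversion writes [mu] through the inner sums over [J \subset K], which are the [lambda]
   values for nonempty [K]. For empty [K] and for singletons these sums are evaluated directly, as 0
   and 1. *)
- rewrite muE -(moebius_subsets m) sum_sets_card_ge2.
  + rewrite EFinD -sumEFin; congr (_ + _)%E; apply: eq_bigr => K K2.
    by rewrite lamKE// (leq_trans _ K2).
  + rewrite (big_pred1 finset.set0) ?m0 ?mulr0// => J.
    by rewrite finset.subset0.
  + move=> i; rewrite (bigD1 [set i]%SET)//= (big_pred1 finset.set0) => [|J].
      by rewrite m0 m1 cards1 mulr0 addr0 mulr1 expr2 mulrNN mulr1.
    rewrite subset1 andb_orl andbN orFb.
    apply/andP/idP => [[]//|/eqP ->]; rewrite eqxx; split=> //.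
    by apply/eqP => /setP/(_ i); rewrite !inE eqxx.
(* For [d = 2] only the full set has at least two elements, so the second expansion reads
   [lam = 2 - mu]. *)
- move=> d2; rewrite lam_card2 (big_pred1 [set: 'I_d]%SET) => [|K].
    rewrite muKE muE cardsT card_ord.
    have [-> ->] : d%:R = 2 :> R /\ (-1) ^+ d.+1 = -1 :> R.
      by rewrite d2; split=> //; rewrite !exprS expr0 mulr1 mulrNN mulr1 mulN1r.
    transitivity (2 - (2 + -1 * m [set: 'I_d]%SET))%:E; last by rewrite EFinB (EFinD 2) EFinM.
    by congr (_%:E); lra.
  by rewrite /= eqEcard finset.subsetT cardsT card_ord /=; move: #|K| => k; rewrite d2.
Qed.
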